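(* (a) Left crossed $C(B_+)$-submodules $M\subseteq\ker\epsilon\subset C(B_+)$ (by left multiplication and left adjoint coaction) are in one-to-one correspondence to pairs $(P,I)$, where $P\in\Bbbk[g]$ is a polynomial with $P(0)=1$ and $I\subset\mathbb N$ is finite, with the additional constraint that $(1-g)$ divides $P(g)$ or $I$ is non-empty. $\operatorname{codim}M<\infty$ if and only if $P=1$. In particular $\operatorname{codim}M=\left(\sum_{n\in I}n\right)-1$ if $P=1$. (b) The infinite codimensional maximal $M$ correspond to pairs $(P,\{1\})$ with $P$ irreducible and $P(g)\ne1-g$.
   Context: $\Bbbk$ is a field of characteristic $0$, $\mathbb N$ the positive integers. $A=C(B_+)=\Bbbk[X,g,g^{-1}]$ is the commutative Hopf algebra with $\Delta X=X\otimes1+g\otimes X$, $\Delta g=g\otimes g$, $\epsilon(X)=0$, $\epsilon(g)=1$, $S X=-g^{-1}X$, $S g=g^{-1}$. A left crossed submodule of $A$ by left multiplication and left adjoint coaction is a subspace $M\subseteq A$ with $AM\subseteq M$ and $\mathrm{Ad_L}(M)\subseteq A\otimes M$, where $\mathrm{Ad_L}(v)=v_{(1)}S v_{(3)}\otimes v_{(2)}$. Here codimension is taken in $\ker\epsilon$, and maximal means maximal among the proper crossed submodules of $\ker\epsilon$.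
   Formalization: In (a) the correspondence is with the nonzero crossed submodules M of ker ε: the zero subspace is a crossed submodule but corresponds to no pair (P,I), since P(0)=1 forces M to be nonzero. *)

(* Defs.v *)
From HB Require Import structures.
From mathcomp Require Import all_boot all_order all_algebra.
From mathcomp Require Import finmap.
From mathcomp Require Import mathcomp_extra boolp classical_sets functions.
From mathcomp Require Import monalg.

Set Implicit Arguments.
Unset Strict Implicit.
Unset Printing Implicit Defensive.

Import GRing.Theory.
Local Open Scope classical_set_scope.
Local Open Scope ring_scope.

(* The library puts a ring structure on {malg R[K]} only when no element of the
   monoid K other than 1 is invertible, which excludes K = nat * int.  So the
   monoid algebra of a commutative additive monoid M is set up here on a copy
   of the free module {malg R[M]}; its basis consists of the [mono m]. *)
Definition monalgebra (R : comNzRingType) (M : nmodType) : Type := {malg R[M]}.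

HB.instance Definition _ (R : comNzRingType) (M : nmodType) :=
  GRing.Lmodule.copy (monalgebra R M) {malg R[M]}.

HB.lock Definition mono {R : comNzRingType} {M : nmodType} (m : M) :
    monalgebra R M :=
  << 1 *g m >>.

(* the linear map with value f m on the basis vector [mono m] *)
HB.lock Definition linext {R : comNzRingType} {M : nmodType} {V : lmodType R}
    (f : M -> V) (u : monalgebra R M) : V :=
  \sum_(m <- msupp u) u@_m *: f m.

Section Linext.
Context {R : comNzRingType} {M : nmodType} {V : lmodType R}.
Implicit Types (u v : monalgebra R M) (f : M -> V).

Lemma linextEw f u (d : {fset M}) :
  (msupp u `<=` d)%fset -> linext f u = \sum_(m <- d) u@_m *: f m.
Proof.
move=> le_d; rewrite linext.unlock (big_fset_incl _ le_d) // => m _ /mcoeff_outdom ->.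
by rewrite scale0r.
Qed.

Fact linext_is_linear f : linear (linext f).
Proof.
move=> a u v.
pose d := (msupp u `|` msupp v `|` msupp (a *: u + v : {malg R[M]}))%fset.
have su : (msupp u `<=` d)%fset by rewrite /d -fsetUA fsubsetUl.
have sv : (msupp v `<=` d)%fset by rewrite /d fsetUAC fsubsetUr.
have sw : (msupp (a *: u + v : {malg R[M]}) `<=` d)%fset by rewrite /d fsubsetUr.
rewrite (linextEw f su) (linextEw f sv) (linextEw f sw) scaler_sumr -big_split /=.
by apply: eq_bigr => m _; rewrite mcoeffD mcoeffZ scalerDl scalerA.
Qed.

HB.instance Definition _ f :=
  GRing.isLinear.Build R (monalgebra R M) V *:%R (linext f) (linext_is_linear f).

Lemma linext_mono f m : linext f (mono m) = f m.
Proof.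
rewrite mono.unlock.
rewrite (linextEw f (msuppU_le : (msupp (<< m >> : {malg R[M]}) `<=` _)%fset)).
by rewrite big_seq_fset1 mcoeffUU scale1r.
Qed.

Lemma monalgebraE u : u = \sum_(m <- msupp u) u@_m *: mono m.
Proof.
rewrite [LHS](monalgE (u : {malg R[M]})); apply: eq_bigr => m _.
by rewrite mono.unlock; apply/malgP => n; rewrite mcoeffZ !mcoeffU mulrnAr mulr1.
Qed.

Lemma monalgebra_ind (P : monalgebra R M -> Prop) :
    P 0 -> (forall a m u, P u -> P (a *: mono m + u)) -> forall u, P u.
Proof.
move=> P0 PD u; rewrite [u]monalgebraE.
elim: (enum_fset _) => [|m r IHr]; first by rewrite big_nil.
by rewrite big_cons; apply: PD.
Qed.

Lemma eq_linear_mono (F G : monalgebra R M -> V) :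
  linear F -> linear G -> (forall m, F (mono m) = G (mono m)) -> F =1 G.
Proof.
move=> linF linG eqFG; have lin0 H : linear H -> H 0 = 0 :> V.
  move=> linH; apply: (addrI (H 0)).
  by have := linH 1 0 0; rewrite !scale1r !addr0 => <-.
by apply: monalgebra_ind => [|a m u IHu]; rewrite ?lin0 // linF linG eqFG IHu.
Qed.

End Linext.

HB.lock Definition monalg_mul {R : comNzRingType} {M : nmodType}
    (u v : monalgebra R M) : monalgebra R M :=
  linext (fun m => linext (fun n => mono (m + n)) v) u.

Section Algebra.
Context (R : comNzRingType) (M : nmodType).
Implicit Types (u v w : monalgebra R M) (m n : M).

Local Notation "u ** v" := (monalg_mul u v) (at level 40, left associativity).

Fact mono_monalg_mul m v : mono m ** v = linext (fun n => mono (m + n)) v.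
Proof. by rewrite monalg_mul.unlock linext_mono. Qed.

Fact monalg_mul_mono m n : mono m ** mono n = mono (m + n) :> monalgebra R M.
Proof. by rewrite mono_monalg_mul linext_mono. Qed.

Fact monalg_mulDl : left_distributive (@monalg_mul R M) +%R.
Proof. by move=> u v w; rewrite monalg_mul.unlock linearD. Qed.

Fact monalg_mulZl a u v : (a *: u) ** v = a *: (u ** v).
Proof. by rewrite monalg_mul.unlock linearZ. Qed.

Fact monalg_mulC : commutative (@monalg_mul R M).
Proof.
move=> u v; rewrite monalg_mul.unlock linext.unlock; under eq_bigr do rewrite scaler_sumr.
rewrite exchange_big /=; apply: eq_bigr => n _.
rewrite scaler_sumr; apply: eq_bigr => m _.
by rewrite !scalerA mulrC addrC.
Qed.

Fact monalg_mulDr : right_distributive (@monalg_mul R M) +%R.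
Proof. by move=> u v w; rewrite !(monalg_mulC u) monalg_mulDl. Qed.

Fact monalg_mulZr a u v : u ** (a *: v) = a *: (u ** v).
Proof. by rewrite !(monalg_mulC u) monalg_mulZl. Qed.

Fact monalg_mul0l v : 0 ** v = 0.
Proof. by rewrite monalg_mul.unlock linear0. Qed.

Fact monalg_mul_linearl v : linear (fun u => u ** v).
Proof. by move=> a u u'; rewrite monalg_mulDl monalg_mulZl. Qed.

Fact monalg_mul_linearr u : linear (fun v => u ** v).
Proof. by move=> a v v'; rewrite monalg_mulDr monalg_mulZr. Qed.

Fact monalg_mulA : associative (@monalg_mul R M).
Proof.
move=> u v w; move: u; apply: eq_linear_mono => [a x y|a x y|m].
- exact: monalg_mul_linearl.
- by rewrite monalg_mul_linearl monalg_mul_linearl.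
move: v; apply: eq_linear_mono => [a x y|a x y|n].
- by rewrite monalg_mul_linearl monalg_mul_linearr.
- by rewrite monalg_mul_linearr monalg_mul_linearl.
move: w; apply: eq_linear_mono => [a x y|a x y|p].
- by rewrite monalg_mul_linearr monalg_mul_linearr.
- exact: monalg_mul_linearr.
by rewrite !monalg_mul_mono addrA.
Qed.

Fact monalg_mul1 : left_id (mono 0) (@monalg_mul R M).
Proof.
apply: eq_linear_mono => [a x y|a x y|m] //; first exact: monalg_mul_linearr.
by rewrite monalg_mul_mono add0r.
Qed.

Fact mono_neq0 m : mono m != 0 :> monalgebra R M.
Proof.
rewrite mono.unlock; apply/eqP => /(congr1 (fun u : {malg R[M]} => u@_m)) /eqP.
by rewrite mcoeffUU mcoeff0 oner_eq0.
Qed.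

HB.instance Definition _ :=
  GRing.Zmodule_isComNzRing.Build (monalgebra R M)
    monalg_mulA monalg_mulC monalg_mul1 monalg_mulDl (mono_neq0 0).

Fact monalg_scaleAl a u v : a *: (u * v) = a *: u * v.
Proof. by rewrite -[RHS]/((a *: u) ** v) monalg_mulZl. Qed.

HB.instance Definition _ :=
  GRing.Lmodule_isLalgebra.Build R (monalgebra R M) monalg_scaleAl.

HB.instance Definition _ :=
  GRing.Lalgebra_isComAlgebra.Build R (monalgebra R M).

Lemma monoD m n : mono (m + n) = mono m * mono n :> monalgebra R M.
Proof. exact/esym/monalg_mul_mono. Qed.

Lemma mono0 : mono 0 = 1 :> monalgebra R M.
Proof. by []. Qed.

Lemma monoMn m i : mono (m *+ i) = mono m ^+ i :> monalgebra R M.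
Proof. by elim: i => // i IHi; rewrite mulrS monoD IHi exprS. Qed.

End Algebra.

Section LinextMonoid.
Context {R : comNzRingType} {M : nmodType} {S : comAlgType R}.

Lemma linext_monoid_morphism (f : M -> S) :
    f 0 = 1 -> {morph f : m n / m + n >-> m * n} ->
  monoid_morphism (linext f).
Proof.
move=> f0 fD; split=> [|u v]; first by rewrite -mono0 linext_mono.
move: u; apply: eq_linear_mono => [a x y|a x y|m].
- by rewrite mulrDl -scalerAl linearP.
- by rewrite linearP mulrDl -scalerAl.
move: v; apply: eq_linear_mono => [a x y|a x y|n].
- by rewrite mulrDr -scalerAr linearP.
- by rewrite linearP mulrDr -scalerAr.
by rewrite -monoD !linext_mono fD.
Qed.

End LinextMonoid.

(* The tensor product of R[M] and R[N] is R[M * N], the basis vector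
   mono m (x) mono n being mono (m, n). *)
HB.lock Definition tens {R : comNzRingType} {M N : nmodType}
    (u : monalgebra R M) (v : monalgebra R N) : monalgebra R (M * N)%type :=
  linext (fun m => linext (fun n => mono (m, n)) v) u.

(* F (x) G for linear maps F and G *)
Definition tensmap {R : comNzRingType} {M N M' N' : nmodType}
    (F : monalgebra R M -> monalgebra R M')
    (G : monalgebra R N -> monalgebra R N') :
    monalgebra R (M * N)%type -> monalgebra R (M' * N')%type :=
  linext (fun mn : M * N => tens (F (mono mn.1)) (G (mono mn.2))).

Notation "u '\ox' v" := (tens u v)
  (at level 40, left associativity, format "u  '\ox'  v") : ring_scope.

Section TensorTheory.
Context {R : comNzRingType} {M N : nmodType}.
Implicit Types (u : monalgebra R M) (v : monalgebra R N).

Lemma tens_mono (m : M) (n : N) :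
  mono m \ox mono n = mono (m, n) :> monalgebra R (M * N)%type.
Proof. by rewrite tens.unlock !linext_mono. Qed.

Lemma tens_linearl v : linear (fun u => u \ox v).
Proof. by move=> a u u'; rewrite tens.unlock linearP. Qed.

Lemma tens_linearr u : linear (fun v => u \ox v).
Proof.
move=> a v v'; elim/(@monalgebra_ind R M): u => [|b m u IHu].
  by rewrite tens.unlock !linear0 ?scaler0 addr0.
rewrite !tens_linearl IHu tens.unlock !linext_mono linearP !scalerDr !scalerA.
rewrite [b * a]mulrC; exact: addrACA.
Qed.

Lemma tensDl u u' v : (u + u') \ox v = u \ox v + u' \ox v.
Proof. by have := tens_linearl v 1 u u'; rewrite !scale1r. Qed.

Lemma tensDr u v v' : u \ox (v + v') = u \ox v + u \ox v'.
Proof. by have := tens_linearr u 1 v v'; rewrite !scale1r. Qed.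

Lemma tens0l v : (0 : monalgebra R M) \ox v = 0.
Proof. by rewrite tens.unlock linear0. Qed.

Lemma tens0r u : u \ox (0 : monalgebra R N) = 0.
Proof. by apply: (addrI (u \ox 0)); rewrite -tensDr !addr0. Qed.

Lemma tensZl a u v : (a *: u) \ox v = a *: (u \ox v).
Proof. by have := tens_linearl v a u 0; rewrite tens0l !addr0. Qed.

Lemma tensZr a u v : u \ox (a *: v) = a *: (u \ox v).
Proof. by have := tens_linearr u a v 0; rewrite tens0r !addr0. Qed.

Lemma tensM u u' v v' : (u * u') \ox (v * v') = (u \ox v) * (u' \ox v').
Proof.
move: u; apply: eq_linear_mono => [a x y|a x y|m].
- by rewrite mulrDl -scalerAl tens_linearl.
- by rewrite tens_linearl mulrDl -scalerAl.
move: u'; apply: eq_linear_mono => [a x y|a x y|m'].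
- by rewrite mulrDr -scalerAr tens_linearl.
- by rewrite tens_linearl mulrDr -scalerAr.
move: v; apply: eq_linear_mono => [a x y|a x y|n].
- by rewrite mulrDl -scalerAl tens_linearr.
- by rewrite tens_linearr mulrDl -scalerAl.
move: v'; apply: eq_linear_mono => [a x y|a x y|n'].
- by rewrite mulrDr -scalerAr tens_linearr.
- by rewrite tens_linearr mulrDr -scalerAr.
by rewrite -!monoD !tens_mono -monoD.
Qed.

Lemma tens11 : 1 \ox 1 = 1 :> monalgebra R (M * N)%type.
Proof. exact: tens_mono. Qed.

End TensorTheory.

(* k[X, g, g^-1] as the monoid algebra of nat * int, mono (n, m) = X^n g^m,
   and its second and third tensor powers *)
Notation CBplus k := (monalgebra k (nat * int)%type).
Notation CBplus2 k := (monalgebra k ((nat * int) * (nat * int))%type).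
Notation CBplus3 k :=
  (monalgebra k (((nat * int) * (nat * int)) * (nat * int))%type).

Section FunctionsBplus.
Context (k : fieldType).
Local Notation A := (CBplus k).
Local Notation A2 := (CBplus2 k).
Local Notation A3 := (CBplus3 k).

Definition gpow (m : int) : A := mono (0%N, m).
Definition genX : A := mono (1%N, 0).
Definition geng : A := gpow 1.

(* Delta, epsilon and S: the algebra maps with the prescribed values at X and
   g, given here on the basis vectors X^n g^m. *)
Definition coprod : A -> A2 := linext (fun b : nat * int =>
  (genX \ox 1 + geng \ox genX) ^+ b.1 * (gpow b.2 \ox gpow b.2)).
Definition counit : A -> k^o :=
  linext (fun b : nat * int => 0 ^+ b.1 : k^o).
Definition antipode : A -> A :=
  linext (fun b : nat * int => (- (gpow (-1) * genX)) ^+ b.1 * gpow (- b.2)).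

(* (Delta (x) id) Delta *)
Definition coprod3 (v : A) : A3 := tensmap coprod id (coprod v).

(* v_(1) S v_(3) (x) v_(2) *)
Definition AdL (v : A) : A2 :=
  linext (fun b : (nat * int) * (nat * int) * (nat * int) =>
    (mono b.1.1 * antipode (mono b.2)) \ox mono b.1.2) (coprod3 v).

Definition kercounit : set A := [set v | counit v = 0].

Definition is_subspace (M : set A) : Prop :=
  M 0 /\ forall a u v, M u -> M v -> M (a *: u + v).

(* A (x) M, as a subspace of A (x) A *)
Definition tensl (M : set A) : set A2 :=
  [set t | exists s : seq (A * A),
     (forall p, p \in s -> M p.2) /\ t = \sum_(p <- s) p.1 \ox p.2].

Definition crossed_submodule (M : set A) : Prop :=
  [/\ is_subspace M,
      forall a v, M v -> M (a * v)
    & forall v, M v -> tensl M (AdL v)].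

(* dim (V / M) = n: V / M has a basis e_0, ..., e_(n-1). *)
Definition has_codim (V M : set A) (n : nat) : Prop :=
  exists e : 'I_n -> A, (forall i, V (e i)) /\
    forall v, V v -> exists! c : 'rV[k]_n, M (v - \sum_i c 0 i *: e i).

Definition finite_codim (V M : set A) : Prop :=
  exists n, has_codim V M n.

Definition maximal_crossed (M : set A) : Prop :=
  [/\ crossed_submodule M, M `<` kercounit
    & forall N, crossed_submodule N -> M `<=` N -> N `<` kercounit -> N = M].

Definition admissible : set ({poly k} * {fset nat}) :=
  [set p | [/\ p.1.[0] = 1, 0%N \notin p.2
             & (1 - 'X %| p.1) \/ p.2 <> fset0]].

(* The crossed submodule attached to (P, I): in X-degree n it consists of the
   Laurent multiples of X^n P(g) (1-g)^d with d the number of elements of I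
   exceeding n, so that I is the set of degrees at which one more factor 1-g
   is dropped; AdL X = X (x) (1-g) + g (x) X (see AdL_X) is the source of these
   factors.  In the sum, s`_n ranges over all of k[X, g, g^-1].  Since
   P(0) = 1, the zero submodule is not of this form. *)
Definition crossed_gen (p : {poly k} * {fset nat}) (n : nat) : A :=
  genX ^+ n * horner_alg geng p.1
    * (1 - geng) ^+ #|` [fset i in p.2 | (n < i)%N]%fset|.

Definition crossed_of (p : {poly k} * {fset nat}) : set A :=
  [set v | exists s : seq A,
     v = \sum_(n < size s) s`_n * crossed_gen p n].

End FunctionsBplus.

Section HopfFacts.
Context {k : fieldType}.
Local Notation A := (CBplus k).
Local Notation X := (genX k).
Local Notation g := (geng k).

Lemma gpowD m n : gpow k (m + n) = gpow k m * gpow k n.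
Proof. by rewrite -monoD. Qed.

Lemma gpow0 : gpow k 0 = 1. Proof. exact: mono0. Qed.

Lemma gVg : gpow k (-1) * g = 1.
Proof. by rewrite -gpowD addNr gpow0. Qed.

Lemma mono_Xg n m : mono (n, m) = X ^+ n * gpow k m :> A.
Proof.
have XnE : genX k ^+ n = mono (n, 0) :> A.
  elim: n => [|n IHn]; first by rewrite expr0 -mono0.
  by rewrite exprS IHn -monoD; congr mono; congr (_, _); rewrite /= ?addr0.
by rewrite XnE -monoD; congr mono; congr (_, _); rewrite /= ?addr0 ?add0r.
Qed.

Lemma coprod_monoid : monoid_morphism (@coprod k).
Proof.
apply: linext_monoid_morphism => [|[n m] [n' m'] /=].
  by rewrite expr0 mul1r gpow0 tens11.
by rewrite exprD gpowD tensM mulrACA.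
Qed.

Lemma counit_monoid : monoid_morphism (@counit k).
Proof. by apply: linext_monoid_morphism => // b b' /=; rewrite exprD. Qed.

Lemma antipode_monoid : monoid_morphism (@antipode k).
Proof.
apply: linext_monoid_morphism => [|[n m] [n' m'] /=].
  by rewrite expr0 mul1r oppr0 gpow0.
by rewrite exprD opprD gpowD mulrACA.
Qed.

Lemma coprod_X : coprod X = X \ox 1 + g \ox X.
Proof. by rewrite /coprod linext_mono /= expr1 gpow0 tens11 mulr1. Qed.

Lemma coprod_g : coprod g = g \ox g.
Proof. by rewrite /coprod linext_mono /= expr0 mul1r. Qed.

Lemma counit_X : counit X = 0.
Proof. by rewrite /counit linext_mono /= expr1. Qed.

Lemma counit_g : counit g = 1.
Proof. by rewrite /counit linext_mono /= expr0. Qed.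

Lemma antipode_X : antipode X = - (gpow k (-1) * X).
Proof. by rewrite /antipode linext_mono /= expr1 oppr0 gpow0 mulr1. Qed.

Lemma antipode_g : antipode g = gpow k (-1).
Proof. by rewrite /antipode linext_mono /= expr0 mul1r. Qed.

Lemma coprod3_X : coprod3 X = X \ox 1 \ox 1 + g \ox X \ox 1 + g \ox g \ox X.
Proof.
rewrite -tensDl -coprod_X -coprod_g /coprod3 [in LHS]coprod_X /tensmap linearD.
by rewrite -[1 in LHS]mono0 !tens_mono /= !linext_mono.
Qed.

Lemma AdL_X : AdL X = X \ox (1 - g) + g \ox X.
Proof.
rewrite /AdL coprod3_X -[1 in LHS]mono0 !tens_mono !linearD /= !linext_mono /=.
rewrite -/X -/(gpow k 1) -/g !mono0 antipode_monoid.1 antipode_X.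
rewrite mulrN mulrA [g * gpow k (-1)]mulrC gVg mul1r !mulr1.
rewrite -scaleN1r tensZl -tensZr scaleN1r addrAC -tensDr; congr (_ + _).
exact: tens_mono.
Qed.

End HopfFacts.

(* Main.v *)
From HB Require Import structures.
Require Import Defs.
From mathcomp Require Import all_boot all_order all_algebra.
From mathcomp Require Import finmap.
From mathcomp Require Import mathcomp_extra boolp classical_sets functions.

Import GRing.Theory.
Local Open Scope classical_set_scope.
Local Open Scope ring_scope.

(** Since A = k[X, g, g^-1] is commutative, the adjoint coaction is an algebra
    map; it sends g to 1 (x) g and X to X (x) (1 - g) + g (x) X, so that
      Ad_L(X^n f(g)) = sum_i C(n, i) X^(n-i) g^i (x) X^i (1 - g)^(n-i) f(g).
    The elements X^j g^i being independent, a crossed submodule M that contains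
    v = sum_n X^n f_n(g) contains every right factor separately: in
    characteristic 0 this means X^i (1 - g)^j f_(i+j) for all i and j
    ([crossed_pieces]).  With j = 0, M is graded by the degree in X, say
    M = (+)_n X^n J_n with J_n an ideal of k[g, g^-1]; with j = 1,
    (1 - g) J_(n+1) is contained in J_n, while J_n is contained in J_(n+1)
    because M is stable under multiplication by X.  If M is nonzero, then so is
    every J_n, and J_n has a unique generator Q_n in k[g] with Q_n(0) = 1.
    The condition on the J_n says that Q_n is Q_(n+1) or (1 - g) Q_(n+1)
    ([crossed_gradedP], [staircase_step]); as the degrees of the Q_n cannot
    decrease forever, Q_n is eventually a polynomial P, and
      Q_n = P (1 - g)^#{i in I | i > n},
    where I is the set of the i > 0 at which the factor 1 - g is dropped
    ([staircase_profile]).  This is the parametrization by pairs (P, I), under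
    which inclusion of submodules becomes divisibility of the Q_n
    ([graded_sub]), and inclusion in ker epsilon becomes divisibility of Q_0
    by 1 - g ([graded_kercounit]).

    For P = 1, M is reached from ker epsilon, whose sequence is 1 - g, 1, 1, ...,
    by multiplying the generators by 1 - g one at a time, each time losing one
    dimension ([graded_step]); the number of steps is
    sum_n #{i in I | i > n} - 1 = sum_(i in I) i - 1.  If P is not constant,
    no Q_n is, and the positive powers of X are independent modulo M
    ([graded_infinite_codim]).  Part (b) is an analysis of divisibility among
    the sequences Q ([crossed_of_irreducible_maximal],
    [maximal_infinite_codim]). *)

(** * Polynomials in X and g inside the Hopf algebra *)

Section Coordinates.
Context {k : fieldType}.
Local Notation A := (CBplus k).
Local Notation X := (genX k).
Local Notation g := (geng k).
Implicit Types (F G : {poly {poly k}}) (p q : {poly k}) (v w : A).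

(** The outer variable stands for X and the inner one for g: F goes to
    sum_n X^n F_n(g). *)
Definition evalXg : {poly {poly k}} -> A :=
  horner_morph (fun p => mulrC X (horner_alg g p)).

HB.instance Definition _ := GRing.RMorphism.copy evalXg
  (horner_morph (fun p => mulrC X (horner_alg g p))).

Lemma evalXgD : {morph evalXg : F G / F + G}. Proof. exact: rmorphD. Qed.
Lemma evalXgB : {morph evalXg : F G / F - G}. Proof. exact: rmorphB. Qed.
Lemma evalXgM : {morph evalXg : F G / F * G}. Proof. exact: rmorphM. Qed.
Lemma evalXg0 : evalXg 0 = 0. Proof. exact: rmorph0. Qed.

Lemma evalXgXn n : evalXg 'X^n = X ^+ n.
Proof. by rewrite [LHS]rmorphXn; congr (_ ^+ _); apply: horner_morphX. Qed.

Lemma evalXgC p : evalXg p%:P = horner_alg g p.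
Proof. exact: horner_morphC. Qed.

Lemma gpowMn m n : gpow k (m *+ n) = gpow k m ^+ n.
Proof.
rewrite -monoMn; congr mono; elim: n => // n IHn.
by rewrite !mulrS -IHn.
Qed.

Lemma gpow_nat n : gpow k n%:Z = g ^+ n.
Proof. by rewrite -gpowMn -mulr_natl mulr1 natz. Qed.

Lemma gpowK m : gpow k (- m) * gpow k m = 1.
Proof. by rewrite -gpowD addNr gpow0. Qed.

Lemma evalXg_sum F :
  evalXg F = \sum_(n < size F) X ^+ n * horner_alg g F`_n.
Proof.
rewrite /evalXg /horner_morph (horner_coef_wide _ (size_poly _ _)).
by apply: eq_bigr => i _; rewrite coef_map mulrC.
Qed.

Lemma evalXg_gX n : evalXg (('X^n)%:P) = gpow k n%:Z.
Proof. by rewrite evalXgC rmorphXn /= horner_algX gpow_nat. Qed.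

(** Clearing denominators: only finitely many negative powers of g occur. *)
Lemma evalXg_onto v : exists (m : nat) F, v = gpow k (- m%:Z) * evalXg F.
Proof.
move: v; apply: monalgebra_ind => [|a [n z] u [m [F ->]]].
  by exists 0%N, 0; rewrite evalXg0 mulr0.
have [s [N def_N]] : exists s N : nat, N%:Z = s%:Z + z.
  case: z => z; first by exists 0%N, z; rewrite add0r.
  by exists z.+1, 0%N; rewrite NegzE addrN.
exists (m + s)%N, ((a%:P * 'X^(m + N))%:P * 'X^n + ('X^s)%:P * F).
rewrite PoszD opprD gpowD evalXgD !evalXgM evalXg_gX evalXgXn evalXgC mulrDr.
congr (_ + _); last first.
  by rewrite mulrA -(mulrA _ _ (gpow _ _)) gpowK mulr1.
rewrite rmorphM /= horner_algC mulr_algl -scalerAl -scalerAr -evalXgC evalXg_gX.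
rewrite mono_Xg mulrA -!gpowD mulrC PoszD def_N; congr (_ *: (gpow _ _ * _)).
by rewrite -opprD [_ + (s%:Z + z)]addrA addKr.
Qed.

(** The polynomial part of the coefficient of X^n, read back from the basis;
    negative powers of g are sent to 0. *)
Definition Xcoef (n : nat) : A -> {poly k} :=
  linext (fun b : nat * int =>
    if b.1 == n then if b.2 is Posz m then 'X^m else 0 else 0).

HB.instance Definition _ n := GRing.Linear.copy (Xcoef n)
  (linext (fun b : nat * int =>
    if b.1 == n then if b.2 is Posz m then 'X^m else 0 else 0)).

Lemma Xcoef_evalXg n F : Xcoef n (evalXg F) = F`_n.
Proof.
have term i p : Xcoef n (X ^+ i * horner_alg g p) = if i == n then p else 0.
  rewrite -{1}[p]coefK poly_def !linear_sum /= mulr_sumr linear_sum /=.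
  under eq_bigr => j _.
    rewrite linearZ /= rmorphXn /= horner_algX -gpow_nat mulr_algl -scalerAr linearZ /=.
    rewrite -mono_Xg /Xcoef linext_mono /=.
    over.
  case: eqP => _; last by rewrite big1 // => j _; rewrite scaler0.
  by rewrite -poly_def coefK.
rewrite evalXg_sum linear_sum /=; under eq_bigr do rewrite term.
have [n_lt|n_ge] := ltnP n (size F).
  by rewrite -big_mkcond /= (big_pred1 (Ordinal n_lt)).
rewrite nth_default // big1 // => i _; case: eqP => // in_; case: i in_ => i /=.
by move=> i_lt in_; rewrite in_ ltnNge n_ge in i_lt.
Qed.

Lemma evalXg_inj : injective evalXg.
Proof. by move=> F G FG; apply/polyP => n; rewrite -!Xcoef_evalXg FG. Qed.
End Coordinates.

(** * The adjoint coaction in coordinates *)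

Section TensorMorphisms.
Context {R : comNzRingType} {M N M' N' : nmodType}.

Lemma tensXn (u : monalgebra R M) (v : monalgebra R N) n :
  (u \ox v) ^+ n = u ^+ n \ox v ^+ n.
Proof. by elim: n => [|n IHn]; rewrite ?tens11 // !exprS IHn tensM. Qed.

Lemma tensmap_monoid (F : monalgebra R M -> monalgebra R M')
    (G : monalgebra R N -> monalgebra R N') :
  monoid_morphism F -> monoid_morphism G -> monoid_morphism (tensmap F G).
Proof.
move=> [F1 FM] [G1 GM]; apply: linext_monoid_morphism => [|[m n] [m' n']] /=.
  by rewrite !mono0 F1 G1 tens11.
by rewrite !monoD FM GM tensM.
Qed.

End TensorMorphisms.

Section AdjointCoaction.
Context {k : fieldType}.
Local Notation A := (CBplus k).
Local Notation A2 := (CBplus2 k).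
Local Notation X := (genX k).
Local Notation g := (geng k).

Let adj (b : (nat * int) * (nat * int) * (nat * int)) : A2 :=
  (mono b.1.1 * antipode (mono b.2)) \ox mono b.1.2.

Fact AdL_is_linear : linear (@AdL k).
Proof. by move=> a u v; rewrite /AdL /coprod3 /coprod /tensmap !linearP. Qed.

HB.instance Definition _ :=
  GRing.isLinear.Build k A A2 *:%R (@AdL k) AdL_is_linear.

(** Multiplicativity of v |-> v_(1) S(v_(3)) (x) v_(2) uses commutativity of the
    Hopf algebra; it makes the coaction computable from its values at X and g. *)
Fact AdL_monoid : monoid_morphism (@AdL k).
Proof.
have [c1 cM] : monoid_morphism (@coprod3 k).
  have [d1 dM] := @coprod_monoid k.
  have [t1 tM] : monoid_morphism (tensmap (@coprod k) (@id A)).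
    by apply: tensmap_monoid; [exact: coprod_monoid | split].
  by split=> [|u v]; rewrite /coprod3 ?d1 ?dM ?t1 ?tM.
have [h1 hM] : monoid_morphism (linext adj).
  have [s1 sM] := @antipode_monoid k.
  apply: linext_monoid_morphism => [|b c]; rewrite /adj /=.
    by rewrite !mono0 s1 mulr1 tens11.
  by rewrite !monoD sM mulrACA tensM.
by split=> [|u v]; rewrite /AdL ?c1 ?cM ?h1 ?hM.
Qed.

HB.instance Definition _ :=
  GRing.isMonoidMorphism.Build A A2 (@AdL k) AdL_monoid.

Lemma coprod_gpow m : coprod (gpow k m) = gpow k m \ox gpow k m.
Proof. by rewrite /coprod linext_mono expr0 mul1r. Qed.

Lemma AdL_gpow m : AdL (gpow k m) = 1 \ox gpow k m.
Proof.
have S_gpow : antipode (gpow k m) = gpow k (- m).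
  by rewrite /antipode linext_mono expr0 mul1r.
rewrite /AdL /coprod3 coprod_gpow {1 2}/gpow tens_mono /tensmap linext_mono /=.
rewrite -/(gpow k m) coprod_gpow /gpow !tens_mono linext_mono /=.
by rewrite -!/(gpow k m) S_gpow mulrC gpowK; apply: tens_mono.
Qed.

Lemma AdL_horner_alg (p : {poly k}) :
  AdL (horner_alg g p) = 1 \ox horner_alg g p.
Proof.
elim/poly_ind: p => [|p c IHp]; first by rewrite !raddf0 tens0r.
have AdLc : AdL c%:A = 1 \ox c%:A :> A2 by rewrite linearZ /= rmorph1 tensZr tens11.
rewrite rmorphD rmorphM /= horner_algX horner_algC linearD /= rmorphM /= IHp AdLc.
by rewrite AdL_gpow -tensM mul1r -tensDr.
Qed.

Lemma AdL_Xn n : AdL (X ^+ n) = \sum_(i < n.+1)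
  (X ^+ (n - i) * g ^+ i) \ox ((1 - g) ^+ (n - i) * X ^+ i) *+ 'C(n, i).
Proof.
rewrite rmorphXn /= AdL_X exprDn; apply: eq_bigr => i _.
by rewrite !tensXn tensM.
Qed.

Lemma AdL_expansion m (F : {poly {poly k}}) :
  AdL (gpow k m * evalXg F) = \sum_(n < size F) \sum_(i < n.+1)
    (X ^+ (n - i) * g ^+ i) \ox
    ('C(n, i)%:R *: (gpow k m *
       (X ^+ i * horner_alg g ((1 - 'X) ^+ (n - i) * F`_n)))).
Proof.
have gather (u v v' w : A) :
    (1 \ox u) * ((v \ox v') * (1 \ox w)) = v \ox (u * (v' * w)).
  by rewrite -!tensM mul1r mulr1.
rewrite rmorphM /= AdL_gpow evalXg_sum rmorph_sum mulr_sumr.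
apply: eq_bigr => n _; rewrite rmorphM /= AdL_Xn AdL_horner_alg.
rewrite mulr_suml mulr_sumr; apply: eq_bigr => i _.
rewrite mulrnAl mulrnAr -scaler_nat tensZr gather.
have -> : horner_alg g ((1 - 'X) ^+ (n - i) * F`_n)
    = (1 - g) ^+ (n - i) * horner_alg g F`_n.
  by rewrite rmorphM rmorphXn rmorphB rmorph1 /= horner_algX.
by rewrite -(mulrA _ (X ^+ i)) (mulrCA _ (X ^+ i)).
Qed.

(** The right factor of the component at the basis vector b of the left factor. *)
Definition slice (b : nat * int) : A2 -> A :=
  linext (fun c : (nat * int) * (nat * int) => (c.1 == b)%:R *: mono c.2).

HB.instance Definition _ b := GRing.Linear.copy (slice b)
  (linext (fun c : (nat * int) * (nat * int) => (c.1 == b)%:R *: mono c.2)).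

Lemma slice_tens_mono b c (v : A) : slice b (mono c \ox v) = (c == b)%:R *: v.
Proof.
move: v; apply: eq_linear_mono => [a x y|a x y|d].
- by rewrite tens_linearr linearP.
- by rewrite scalerDr !scalerA mulrC.
by rewrite tens_mono /slice linext_mono.
Qed.

(** This is how stability under the coaction is used: it puts every slice
    of Ad_L(v) in M. *)
Lemma slice_tensl (M : set A) b t : is_subspace M -> tensl M t -> M (slice b t).
Proof.
move=> [M0 MD] [s [Ms ->]] {t}; elim: s Ms => [|[u v] s IHs] Ms.
  by rewrite big_nil linear0.
rewrite big_cons linearD /=; have Mv: M v by apply: (Ms (u, v)); rewrite mem_head.
have {}IHs : M (slice b (\sum_(j <- s) j.1 \ox j.2)).
  by apply: IHs => p sp; apply: Ms; rewrite inE sp orbT.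
move: u {Ms}; apply: monalgebra_ind => [|a c u IHu].
  by rewrite tens0l linear0 add0r.
rewrite tens_linearl linearP -addrA /= slice_tens_mono scalerA.
exact: MD.
Qed.

End AdjointCoaction.

(** * Subspaces graded by the degree in X *)

Section GradedSubmodules.
Context {k : fieldType}.
Local Notation A := (CBplus k).
Local Notation X := (genX k).
Local Notation g := (geng k).
Implicit Types (F G : {poly {poly k}}) (p q : {poly k}) (v w : A).
Implicit Types (Q : nat -> {poly k}) (M : set A).

(** The sum over n of X^n times the ideal (Q n) of k[g, g^-1], written with a
    common denominator g^m. *)
Definition graded Q : set A :=
  [set v | exists (m : nat) F,
     v = gpow k (- m%:Z) * evalXg F /\ forall n, Q n %| F`_n].

Definition normalized Q := forall n, (Q n).[0] = 1.

Lemma dvdp_mulXn p q m : p.[0] = 1 -> (p %| 'X^m * q) = (p %| q).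
Proof.
move=> p0; apply: Gauss_dvdpr; apply: coprimep_expr.
by rewrite coprimepX rootE p0 oner_eq0.
Qed.

Lemma evalXg_denom (m a : nat) F :
  gpow k (- m%:Z) * evalXg F
  = gpow k (- (m + a)%N%:Z) * evalXg (('X^a)%:P * F).
Proof.
rewrite evalXgM evalXg_gX mulrA -gpowD; congr (gpow _ _ * _).
by rewrite PoszD opprD addrNK.
Qed.

(** Membership can be tested after clearing any denominator, since the
    generators Q n are prime to g. *)
Lemma gradedP Q (m : nat) F : normalized Q ->
  graded Q (gpow k (- m%:Z) * evalXg F) <-> forall n, Q n %| F`_n.
Proof.
move=> Q0; split=> [[m' [F' [eqFF' F'Q]]] n|FQ]; last by exists m, F.
have clear_denom (d : nat) v : gpow k d * (gpow k (- d%:Z) * v) = v.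
  by rewrite mulrA [gpow k d * _]mulrC gpowK mul1r.
have eqF : evalXg (('X^m')%:P * F) = evalXg (('X^m)%:P * F').
  rewrite !evalXgM !evalXg_gX -[in LHS](clear_denom m (evalXg F)) eqFF'.
  by rewrite mulrCA clear_denom.
rewrite -(dvdp_mulXn _ _ m' (Q0 n)) -coefCM (evalXg_inj _ _ eqF) coefCM.
exact: dvdp_mull.
Qed.

Lemma coef_piece p n i : (p%:P * 'X^n)`_i = if i == n then p else 0 :> {poly k}.
Proof. by rewrite coefCM coefXn; case: eqP; rewrite ?mulr1 ?mulr0. Qed.

Lemma evalXg_piece p n :
  evalXg (p%:P * 'X^n) = X ^+ n * horner_alg g p.
Proof. by rewrite evalXgM evalXgC evalXgXn mulrC. Qed.

Lemma graded_piece Q (m : nat) n p : normalized Q ->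
  graded Q (gpow k (- m%:Z) * (X ^+ n * horner_alg g p)) <-> Q n %| p.
Proof.
move=> Q0; rewrite -evalXg_piece gradedP //; split=> [/(_ n)|Qp i].
  by rewrite coef_piece eqxx.
by rewrite coef_piece; case: eqP => [->|]; rewrite ?dvdp0.
Qed.

Lemma graded_subspace Q : is_subspace (graded Q).
Proof.
split=> [|a _ _ [m [F [-> FQ]]] [m' [F' [-> F'Q]]]].
  by exists 0%N, 0; rewrite evalXg0 mulr0; split=> // n; rewrite coef0 dvdp0.
exists (m + m')%N, ((a%:P * 'X^m')%:P * F + ('X^m)%:P * F'); split=> [|n].
  rewrite (evalXg_denom m m') (evalXg_denom m' m) addnC scalerAr -mulrDr.
  congr (_ * _); rewrite evalXgD; congr (_ + _).
  by rewrite polyCM -mulrA [RHS]evalXgM evalXgC horner_algC mulr_algl.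
rewrite coefD !coefCM -mulrA; apply: dvdp_add; last exact: dvdp_mull.
by rewrite !dvdp_mull.
Qed.

Lemma subspaceD M v w : is_subspace M -> M v -> M w -> M (v + w).
Proof. by move=> [_ MD] Mv Mw; rewrite -[v]scale1r; apply: MD. Qed.

Lemma subspaceZ M a v : is_subspace M -> M v -> M (a *: v).
Proof. by move=> [M0 MD] Mv; rewrite -[_ *: _]addr0; apply: MD. Qed.

Lemma subspace_sum M (I : Type) (r : seq I) (P : pred I) (f : I -> A) :
  is_subspace M -> (forall i, P i -> M (f i)) -> M (\sum_(i <- r | P i) f i).
Proof.
move=> subM Mf; elim/big_ind: _ => //; first by case: subM.
by move=> v w; apply: subspaceD.
Qed.

Lemma tensl_tens M u v : M v -> tensl M (u \ox v).
Proof.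
by move=> Mv; exists [:: (u, v)]; rewrite big_seq1; split=> // p /[!inE]/eqP->.
Qed.

Lemma tensl_sum M (I : Type) (r : seq I) (f : I -> CBplus2 k) :
  (forall i, tensl M (f i)) -> tensl M (\sum_(i <- r) f i).
Proof.
move=> Mf; elim/big_ind: _ => //; first by exists nil; rewrite big_nil.
move=> _ _ [s [Ms ->]] [t [Mt ->]]; exists (s ++ t); rewrite big_cat.
by split=> // p; rewrite mem_cat => /orP[/Ms|/Mt].
Qed.

Definition decreasing Q := forall n, Q n.+1 %| Q n.

Lemma decreasing_dvdp Q i n : decreasing Q -> (i <= n)%N -> Q n %| Q i.
Proof.
move=> dQ /subnK <-; elim: (n - i)%N => [|d IHd]; first exact: dvdpp.
by apply: dvdp_trans IHd; rewrite addSn.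
Qed.

Lemma graded_ideal Q a v : decreasing Q -> graded Q v -> graded Q (a * v).
Proof.
move=> dQ [m [F [-> FQ]]]; have [m' [G ->]] := evalXg_onto a.
exists (m' + m)%N, (G * F); split=> [|n].
  by rewrite mulrACA -gpowD evalXgM PoszD opprD.
rewrite coefM; apply: (big_ind (fun p => Q n %| p)) => [|p q|i _].
- exact: dvdp0.
- exact: dvdp_add.
by apply/dvdp_mull/(dvdp_trans _ (FQ _))/decreasing_dvdp; rewrite ?leq_subr.
Qed.

(** These are the sequences of generators of crossed submodules: multiplication
    by X gives Q n.+1 %| Q n, and the coaction gives the last condition. *)
Definition staircase Q :=
  [/\ normalized Q, decreasing Q & forall n, Q n %| (1 - 'X) * Q n.+1].

Lemma staircase_dvdp Q i d : staircase Q -> Q i %| (1 - 'X) ^+ d * Q (i + d)%N.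
Proof.
move=> [_ _ dQ]; elim: d => [|d IHd]; first by rewrite expr0 mul1r addn0.
apply: (dvdp_trans IHd); rewrite exprSr addnS -mulrA.
exact: dvdp_mul.
Qed.
End GradedSubmodules.

(** * Principal generators of saturated ideals *)

Section PolynomialIdeals.
Context {k : fieldType}.

(** A nonzero element of least degree divides all the others. *)
Lemma poly_ideal_principal (J : {poly k} -> Prop) :
    J 0 -> (forall p q, J p -> J q -> J (p - q)) ->
    (forall p q, J q -> J (p * q)) ->
  exists q, forall p, J p <-> q %| p.
Proof.
move=> J0 JB JM.
pose has_size n := `[< exists q, [/\ J q, q != 0 & size q = n] >].
have [ex_size|no_size] := pselect (exists n, has_size n); last first.
  exists 0 => p; rewrite dvd0p; split=> [Jp|/eqP->] //.
  apply: contraT => pN0; case: no_size; exists (size p); apply/asboolP.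
  by exists p.
case: (ex_minnP ex_size) => n /asboolP[q [Jq qN0 <-]] min_q {n}.
exists q => p; split=> [Jp|/dvdpP[r ->]]; last exact: JM.
rewrite /dvdp; apply: contraT => mod_neq0.
have Jmod : J (p %% q).
  have -> : p %% q = p - (p %/ q) * q 
    by apply/eqP; rewrite eq_sym subr_eq addrC -divp_eq.
  exact/JB/JM.
suff: (size q <= size (p %% q)%R)%N by rewrite leqNgt ltn_modp qN0.
by apply: min_q; apply/asboolP; exists (p %% q).
Qed.

(** An ideal of k[g] that is the trace of one of k[g, g^-1] is saturated for g,
    so that its generator does not vanish at 0 and can be normalized. *)
Lemma saturated_ideal_principal (J : {poly k} -> Prop) (p0 : {poly k}) :
    J 0 -> (forall p q, J p -> J q -> J (p - q)) ->
    (forall p q, J q -> J (p * q)) -> (forall p, J (p * 'X) -> J p) ->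
    J p0 -> p0 != 0 ->
  exists q, q.[0] = 1 /\ forall p, J p <-> q %| p.
Proof.
move=> J0 JB JM JX Jp0 p0N0; have [q Jq] := poly_ideal_principal J J0 JB JM.
have qN0 : q != 0.
  by apply: contraNneq p0N0 => q0; move/Jq: Jp0; rewrite q0 dvd0p.
have q0N0 : q.[0] != 0.
  apply/negP => /factor_theorem[r]; rewrite subr0 => def_q.
  have : J r by apply: JX; rewrite -def_q; apply/Jq/dvdpp.
  move/Jq; have rN0 : r != 0 by apply: contraNneq qN0 => r0; rewrite def_q r0 mul0r.
  by move=> /(dvdp_leq rN0); rewrite def_q size_mulX // ltnn.
exists (q.[0]^-1 *: q); rewrite hornerZ mulVf //; split=> // p.
by rewrite dvdpZl ?invr_eq0.
Qed.

End PolynomialIdeals.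

(** * Crossed submodules are graded *)

Section Classification.
Context {k : fieldType}.
Local Notation A := (CBplus k).
Local Notation X := (genX k).
Local Notation g := (geng k).
Implicit Types (F G : {poly {poly k}}) (p q : {poly k}) (v w : A).
Implicit Types (Q : nat -> {poly k}) (M : set A).

(** The right factors of Ad_L(X^n f) are X^i (1 - g)^(n-i) f, and Q i divides
    (1 - g)^(n-i) Q n. *)
Lemma graded_crossed Q : staircase Q -> crossed_submodule (graded Q).
Proof.
move=> stQ; have [Q0 dQ _] := stQ; split; first exact: graded_subspace.
  by move=> a v; apply: graded_ideal.
move=> _ [m [F [-> FQ]]]; rewrite AdL_expansion.
apply: tensl_sum => n; apply: tensl_sum => i; apply: tensl_tens.
apply: subspaceZ; first exact: graded_subspace.
apply/graded_piece => //.
have le_in : (i <= n)%N by rewrite -ltnS.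
apply: (dvdp_trans (staircase_dvdp _ i (n - i) stQ)).
by rewrite subnKC // dvdp_mul.
Qed.

(** The basis vector X^j g^i occurs on the left of Ad_L(X^n f) only for
    n = i + j, in the summand of index i. *)
Lemma sum_triangle_pick (V : zmodType) N i j (f : nat -> nat -> V) :
    (i + j < N)%N ->
    (forall n a, (a <= n)%N -> (a, n - a)%N != (i, j) -> f n a = 0) ->
  \sum_(n < N) \sum_(a < n.+1) f n a = f (i + j)%N i.
Proof.
move=> ijN f0; have lt_i : (i < (i + j).+1)%N by rewrite ltnS leq_addr.
rewrite (bigD1 (Ordinal ijN)) //= (bigD1 (Ordinal lt_i)) //=.
rewrite big1 ?addr0 => [|a aNi]; last first.
  by apply: f0; [rewrite -ltnS | rewrite xpair_eqE (negPf (aNi : val a != i))].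
rewrite big1 ?addr0 // => n nNij; apply: big1 => a _.
have le_an : (a <= n)%N by rewrite -ltnS.
apply: f0 => //; apply: contraNneq nNij => -[a_i n_j].
by rewrite -val_eqE /= -a_i -n_j subnKC.
Qed.

Lemma slice_AdL m F i j : (i + j < size F)%N ->
  slice (j, i%:Z) (AdL (gpow k m * evalXg F)) = 'C(i + j, i)%:R *:
    (gpow k m * (X ^+ i * horner_alg g ((1 - 'X) ^+ j * F`_(i + j)))).
Proof.
move=> ijF; pose w n a := 'C(n, a)%:R *: (gpow k m *
  (X ^+ a * horner_alg g ((1 - 'X) ^+ (n - a) * F`_n))).
pose f n a := slice (j, i%:Z) ((X ^+ (n - a) * g ^+ a) \ox w n a).
have fE n a : f n a = ((n - a == j)%N && (a == i))%:R *: w n a.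
  by rewrite /f -gpow_nat -mono_Xg slice_tens_mono xpair_eqE eqz_nat.
rewrite AdL_expansion linear_sum.
transitivity (\sum_(n < size F) \sum_(a < n.+1) f n a).
  by apply: eq_bigr => n _; rewrite linear_sum.
rewrite (sum_triangle_pick _ _ _ _ _ ijF) => [|n a _]; last first.
  by rewrite fE xpair_eqE andbC => /negPf->; rewrite scale0r.
by rewrite fE addKn !eqxx scale1r /w addKn.
Qed.

(** In the slice at X^j g^i the binomial coefficient C(i + j, i) is invertible
    in characteristic 0.  For j = 0 this gives the X-homogeneous components. *)
Lemma crossed_pieces M m F i j : [pchar k] =i pred0 -> crossed_submodule M ->
  M (gpow k m * evalXg F) ->
  M (X ^+ i * horner_alg g ((1 - 'X) ^+ j * F`_(i + j))).
Proof.
move=> /pcharf0P char0 [subM idM coM] Mv.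
have [ijF|Fij] := ltnP (i + j) (size F); last first.
  by rewrite nth_default // mulr0 rmorph0 mulr0; case: subM.
have := slice_tensl M (j, i%:Z) _ subM (coM _ Mv); rewrite slice_AdL //.
have binN0 : ('C(i + j, i)%:R != 0 :> k).
  by rewrite char0 -lt0n bin_gt0 leq_addr.
move/(subspaceZ M ('C(i + j, i)%:R^-1) _ subM); rewrite scalerA mulVf // scale1r.
by move/(idM (gpow k (- m))); rewrite mulrA gpowK mul1r.
Qed.

(** J n consists of the f in k[g] with X^n f(g) in M.  One nonzero J N forces
    all of them to be nonzero: multiply by X to go up from N, and by 1 - g to
    go down, so that every J n has a normalized generator. *)
Lemma crossed_gradedP M : [pchar k] =i pred0 -> crossed_submodule M ->
  M <> [set 0] -> exists2 Q, staircase Q & M = graded Q.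
Proof.
move=> char0 crM MN0; have [subM idM _] := crM.
pose J n p := M (X ^+ n * horner_alg g p).
have J0 n : J n 0 by rewrite /J rmorph0 mulr0; case: subM.
have JM n p q : J n q -> J n (p * q).
  by rewrite /J rmorphM mulrCA => Jq; apply: idM.
have JB n p q : J n p -> J n q -> J n (p - q).
  move=> Jp /(JM n (- 1)) Jq; rewrite -mulN1r /J rmorphD mulrDr.
  exact: (subspaceD M _ _ subM Jp Jq).
have JX n p : J n (p * 'X) -> J n p.
  move/(idM (gpow k (-1))); rewrite rmorphM /= horner_algX.
  by rewrite mulrCA [gpow _ _ * (_ * g)]mulrCA gVg mulr1.
have Jup n p : J n p -> J n.+1 p by move=> /(idM X); rewrite mulrA -exprS.
have Jdown n j p : J (n + j)%N p -> J n ((1 - 'X) ^+ j * p).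
  rewrite /J -evalXg_piece -[evalXg _]mul1r -[1]gpow0.
  move/(crossed_pieces _ _ _ n j char0 crM).
  by rewrite coef_piece eqxx.
have MJ (m : nat) F : M (gpow k (- m%:Z) * evalXg F) <-> forall n, J n F`_n.
  split=> [Mv n|JF].
    by have := crossed_pieces _ _ _ n 0 char0 crM Mv; rewrite expr0 mul1r addn0.
  by apply: idM; rewrite evalXg_sum; apply: subspace_sum => // n _; apply: JF.
have [N [p JNp pN0]] : exists N, exists2 p, J N p & p != 0.
  apply: contrapT => noJ; apply: MN0; apply/seteqP; split=> [v|v ->]; last by case: subM.
  have [m [F ->]] := evalXg_onto v => /MJ JF /=.
  suff -> : F = 0 by rewrite evalXg0 mulr0.
  apply/polyP => n; rewrite coef0; apply/eqP; apply: contraT => FnN0.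
  by case: noJ; exists n, F`_n.
have X1N0 : 1 - 'X != 0 :> {poly k}.
  by rewrite -opprB oppr_eq0 polyXsubC_eq0.
have /boolp.choice[Q QP] n : exists q, q.[0] = 1 /\ forall p, J n p <-> q %| p.
  have [p' Jp' p'N0] : exists2 p', J n p' & p' != 0.
    have [leNn|ltnN] := leqP N n.
      exists p => //; rewrite -(subnKC leNn).
      by elim: (n - N)%N => [|d /Jup]; rewrite ?addn0 ?addnS.
    exists ((1 - 'X) ^+ (N - n) * p); last by rewrite mulf_neq0 ?expf_neq0.
    by apply: Jdown; rewrite subnKC // ltnW.
  have generator := saturated_ideal_principal (J n) p' (J0 n) (JB n) (JM n).
  exact: generator (JX n) Jp' p'N0.
have Q0 : normalized Q by move=> n; have [] := QP n.
have JQ n q : J n q <-> Q n %| q by have [_] := QP n.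
exists Q; first split=> // n.
- by apply/JQ/Jup/JQ/dvdpp.
- apply/JQ; rewrite -['X]expr1 -[1 - _]expr1; apply/Jdown; rewrite addn1.
  exact/JQ/dvdpp.
apply/seteqP; split=> v; have [m [F ->]] := evalXg_onto v.
  move/(MJ m F) => JF.
  apply/(gradedP Q m F Q0) => n.
  exact: (JQ n _).1 (JF n).
by move/(gradedP Q m F Q0) => FQ; apply/MJ => n; apply/JQ.
Qed.

End Classification.

(** * Staircases and pairs (P, I) *)

Section StaircaseParameters.
Context {k : fieldType}.
Implicit Types (p q r : {poly k}) (I : {fset nat}) (Q : nat -> {poly k}).
Local Notation Xm := (1 - 'X : {poly k}).

Lemma horner0_oneBX : Xm.[0] = 1.
Proof. by rewrite !hornerE subr0. Qed.

Lemma oneBX_neq0 : Xm != 0.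
Proof. by rewrite -opprB oppr_eq0 polyXsubC_eq0. Qed.

Lemma horner0_neq0 p : p.[0] = 1 -> p != 0.
Proof.
by move=> p0; apply/eqP => p_0; move/eqP: p0; rewrite p_0 horner0 eq_sym oner_eq0.
Qed.

Lemma oneBX_dvdp p : (Xm %| p) = (p.[1] == 0).
Proof. by rewrite -opprB dvdpNl dvdp_XsubCl. Qed.

Lemma normalized_eqp p q : p.[0] = 1 -> q.[0] = 1 -> p %= q -> p = q.
Proof.
move=> p0 q0 /eqp_eq eq_pq; have := congr1 (horner^~ 0) eq_pq.
rewrite !hornerZ p0 q0 !mulr1 => eq_lead; move: eq_pq; rewrite eq_lead.
by apply: scalerI; rewrite lead_coef_eq0 horner0_neq0.
Qed.

Lemma normalized_dvdp_anti p q :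
  p.[0] = 1 -> q.[0] = 1 -> p %| q -> q %| p -> p = q.
Proof. by move=> p0 q0 pq qp; apply: normalized_eqp; rewrite // /eqp pq. Qed.

(** The only divisors of the linear polynomial 1 - g are constants and itself,
    up to scalars. *)
Lemma dvdp_oneBX r : r.[0] = 1 -> r %| Xm -> r = 1 \/ r = Xm.
Proof.
move=> r0; rewrite -{1}opprB dvdpNr => /(irredp_XsubCP (irredp_XsubC 1))[r1|rX].
  by left; apply: normalized_eqp; rewrite ?hornerC.
right; apply: (normalized_eqp _ _ r0 horner0_oneBX).
by rewrite (eqp_trans rX) // -['X - _]opprB -scaleN1r eqp_scale // oppr_eq0 oner_eq0.
Qed.

(** The exponent of 1 - g in degree n in the definition of [crossed_gen]. *)
Definition tail I n := #|` [fset i in I | (n < i)%N]%fset|.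

Lemma tailS I n : tail I n = ((n.+1 \in I) + tail I n.+1)%N.
Proof.
have gtS i : i != n.+1 -> (n < i)%N = (n.+1 < i)%N.
  by move=> iNn1; rewrite [RHS]ltn_neqAle eq_sym iNn1.
rewrite /tail; have [n1I|n1I] := boolP (n.+1 \in I).
  rewrite (_ : [fset i in I | (n < i)%N] = n.+1 |` [fset i in I | (n.+1 < i)%N])%fset.
    by rewrite cardfsU1 !inE ltnn andbF.
  apply/fsetP => i; rewrite !inE.
  have [->|/gtS->] := eqVneq i n.+1; first by rewrite n1I ltnSn.
  by [].
congr #|` _|; apply/fsetP => i; rewrite !inE.
by have [->|/gtS->] := eqVneq i n.+1; first by rewrite (negPf n1I).
Qed.

Lemma tail_eq0 I n : (forall i, i \in I -> (i <= n)%N) -> tail I n = 0%N.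
Proof.
move=> leI; apply/eqP; rewrite cardfs_eq0; apply/eqP/fsetP => i.
rewrite !inE; apply/negP => /andP[/leI]; rewrite leqNgt.
by move/negPf->.
Qed.

Lemma tailE I n : tail I n = (\sum_(i <- I | (n < i)%N) 1)%N.
Proof. by rewrite big_fset_condE sum1_size. Qed.

Lemma tail1 j n : tail [fset j]%fset n = (n < j)%N.
Proof. by rewrite tailE big_mkcond big_seq_fset1; case: ifP. Qed.

Lemma tail_gt0 I : 0%N \notin I -> I != fset0 -> (0 < tail I 0)%N.
Proof.
move=> I0 /fset0Pn[i iI]; rewrite /tail cardfs_gt0; apply/fset0Pn.
by exists i; rewrite !inE iI lt0n; apply: contraNneq I0 => <-.
Qed.

Definition profile (p : {poly k} * {fset nat}) n := p.1 * Xm ^+ tail p.2 n.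

Lemma profileS (p : {poly k} * {fset nat}) n :
  profile p n = Xm ^+ (n.+1 \in p.2) * profile p n.+1.
Proof. by rewrite /profile tailS exprD mulrCA. Qed.

Lemma profile_large (p : {poly k} * {fset nat}) :
  exists N, forall n, (N <= n)%N -> profile p n = p.1.
Proof.
exists (\max_(i <- p.2) i)%N => n leNn; rewrite /profile tail_eq0 ?mulr1 // => i pi.
by apply: leq_trans leNn; apply: leq_bigmax_seq.
Qed.

Lemma profile_staircase (p : {poly k} * {fset nat}) :
  p.1.[0] = 1 -> staircase (profile p).
Proof.
move=> p0; split=> n.
- by rewrite /profile hornerM horner_exp horner0_oneBX expr1n mulr1.
- by rewrite (profileS p n) dvdp_mull.
- by rewrite (profileS p n); case: (_ \in _); rewrite ?expr1 // mul1r dvdp_mull.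
Qed.

(** The polynomial is the eventual value of the profile, and n + 1 is in the
    finite set exactly when the profile drops from n to n + 1. *)
Lemma profile_inj (p q : {poly k} * {fset nat}) :
    p.1.[0] = 1 -> 0%N \notin p.2 -> 0%N \notin q.2 ->
  profile p =1 profile q -> p = q.
Proof.
move=> p0 pN0 qN0 eq_pq; have eq1 : p.1 = q.1.
  have [[N pN] [N' qN']] := (profile_large p, profile_large q).
  by rewrite -(pN (N + N')%N) ?leq_addr // eq_pq qN' ?leq_addl.
have p1N0 := horner0_neq0 _ p0.
have size_exp d : size (Xm ^+ d) = d.+1.
  rewrite -[LHS]prednK ?size_poly_gt0 ?expf_neq0 ?oneBX_neq0 //.
  by rewrite size_exp -opprB size_polyN size_XsubC mul1n.
have eq_tail n : tail p.2 n = tail q.2 n.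
  have := eq_pq n; rewrite /profile -eq1 => /(mulfI p1N0).
  move=> /(congr1 (fun r : {poly k} => size r)).
  by rewrite !size_exp => -[].
case: p q pN0 qN0 eq1 eq_tail {eq_pq p1N0 p0} => [P I] [P' I'] /= I0 I'0 -> eq_tail.
congr (_, _); apply/fsetP => -[|n]; first by rewrite (negPf I0) (negPf I'0).
have := eq_tail n; rewrite (tailS I n) (tailS I' n) eq_tail => /addIn.
by case: (_ \in _); case: (_ \in _).
Qed.

Lemma staircase_step Q n : staircase Q ->
  Q n = Q n.+1 \/ Q n = Xm * Q n.+1.
Proof.
move=> [Q0 dQ uQ]; have /dvdpP[r def_Qn] := dQ n.
have r0 : r.[0] = 1 by have := Q0 n; rewrite def_Qn hornerM Q0 mulr1.
have := uQ n; rewrite def_Qn dvdp_mul2r ?horner0_neq0 // => /(dvdp_oneBX _ r0).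
by case=> ->; [left; rewrite mul1r | right].
Qed.

(** The sizes of the Q n are nonincreasing; past the index where the least one
    is attained, the divisibility Q n %| Q N is an equality. *)
Lemma staircase_stationary Q : staircase Q ->
  exists N, forall n, (N <= n)%N -> Q n = Q N.
Proof.
move=> [Q0 dQ _]; pose attained s := `[< exists n, size (Q n) = s >].
have ex_s : exists s, attained s by exists (size (Q 0%N)); apply/asboolP; exists 0%N.
case: (ex_minnP ex_s) => s /asboolP[N <-] min_s; exists N => n leNn.
apply: normalized_eqp => //.
have QnN := decreasing_dvdp _ _ _ dQ leNn.
rewrite -dvdp_size_eqp // eqn_leq dvdp_leq ?horner0_neq0 //=.
by apply: min_s; apply/asboolP; exists n.
Qed.

(** P is the stationary value and I the set of the i with Q i.-1 != Q i; the
    equality with the profile is proved downwards from the stationary range. *)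
Lemma staircase_profile Q : staircase Q ->
  exists p : {poly k} * {fset nat}, [/\ p.1.[0] = 1, 0%N \notin p.2 & Q = profile p].
Proof.
move=> stQ; have [Q0 _ _] := stQ; have [N QN] := staircase_stationary _ stQ.
pose I := [fset i in iota 1 N | Q i.-1 != Q i]%fset.
exists (Q N, I); split=> //=; first by rewrite !inE mem_iota.
suff Qd d n : (N <= n + d)%N -> Q n = profile (Q N, I) n.
  by apply/funext => n; apply: (Qd N); rewrite leq_addl.
elim: d n => [|d IHd] n leN.
  rewrite addn0 in leN; rewrite /profile tail_eq0 ?mulr1 ?QN //= => i.
  rewrite !inE mem_iota add1n ltnS => /andP[/andP[_ le_iN] _].
  exact: leq_trans leN.
rewrite profileS -IHd ?addSnnS //= !inE mem_iota /= add1n ltnS.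
have [lt_nN|le_Nn] := ltnP n N; last by rewrite mul1r !QN ?(leq_trans le_Nn).
have [eqQ|neqQ] /= := eqVneq (Q n) (Q n.+1); first by rewrite mul1r.
case: (staircase_step _ n stQ) neqQ => [->|-> _]; first by rewrite eqxx.
by rewrite expr1.
Qed.

End StaircaseParameters.

(** * Inclusions between graded subspaces *)

Section CrossedOf.
Context {k : fieldType}.
Local Notation A := (CBplus k).
Local Notation X := (genX k).
Local Notation g := (geng k).
Implicit Types (F G : {poly {poly k}}) (v w : A) (Q : nat -> {poly k}).
Implicit Types (p : {poly k} * {fset nat}).

Lemma crossed_gen_profile p n :
  crossed_gen p n = X ^+ n * horner_alg g (profile p n).
Proof.
rewrite /crossed_gen /profile rmorphM rmorphXn rmorphB rmorph1 /= horner_algX.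
by rewrite mulrA.
Qed.

Lemma crossed_of_graded p : p.1.[0] = 1 -> crossed_of p = graded (profile p).
Proof.
move=> p0; have [Q0 dQ _] := profile_staircase _ p0.
apply/seteqP; split=> [_ [s ->]|_ [m [F [-> FQ]]]].
  apply: subspace_sum => [|n _]; first exact: graded_subspace.
  apply: graded_ideal => //; rewrite crossed_gen_profile.
  have := (graded_piece _ 0 n _ Q0).2 (dvdpp (profile p n)).
  by rewrite oppr0 gpow0 mul1r.
exists (mkseq (fun n => gpow k (- m%:Z) * horner_alg g (F`_n %/ profile p n)) (size F)).
rewrite size_mkseq evalXg_sum mulr_sumr; apply: eq_bigr => n _.
rewrite nth_mkseq // crossed_gen_profile -mulrA; congr (_ * _).
by rewrite mulrCA -rmorphM /= divpK.
Qed.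

Lemma graded_sub Q Q' : normalized Q -> normalized Q' ->
  graded Q `<=` graded Q' <-> forall n, Q' n %| Q n.
Proof.
move=> Q0 Q'0; split=> [sQQ' n|dQ'Q _ [m [F [-> FQ]]]].
  apply/(graded_piece Q' 0 n _ Q'0)/sQQ'.
  exact/graded_piece.
by exists m, F; split=> // n; apply: dvdp_trans (FQ n).
Qed.

Lemma graded_inj Q Q' : normalized Q -> normalized Q' ->
  graded Q = graded Q' -> Q =1 Q'.
Proof.
move=> Q0 Q'0 eqQ n; apply: normalized_dvdp_anti; rewrite ?Q0 ?Q'0 //.
  by apply: (graded_sub Q' Q Q'0 Q0).1; rewrite eqQ.
by apply: (graded_sub Q Q' Q0 Q'0).1; rewrite eqQ.
Qed.

HB.instance Definition _ := GRing.Linear.copy (@counit k)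
  (linext (fun b : nat * int => 0 ^+ b.1 : k^o)).
HB.instance Definition _ :=
  GRing.isMonoidMorphism.Build A k^o (@counit k) counit_monoid.

Lemma counit_evalXg m F : counit (gpow k m * evalXg F) = (F`_0%N).[1].
Proof.
have eps_p (p : {poly k}) : counit (horner_alg g p) = p.[1].
  elim/poly_ind: p => [|p c IHp]; first by rewrite !raddf0 horner0.
  rewrite rmorphD rmorphM /= horner_algX horner_algC linearD /= rmorphM /= IHp.
  rewrite counit_g linearZ /= rmorph1 hornerMXaddC !mulr1.
  by congr (_ + _); apply: mulr1.
have eps_g : counit (gpow k m) = 1 by rewrite /counit linext_mono.
rewrite rmorphM /= eps_g mul1r evalXg_sum linear_sum /=.
have term n (p : {poly k}) : counit (X ^+ n * horner_alg g p) = (n == 0%N)%:R * p.[1].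
  by rewrite rmorphM rmorphXn /= counit_X eps_p expr0n.
under eq_bigr do rewrite term.
case: F => -[|f0 s] /= sP; first by rewrite big_ord0 horner0.
rewrite big_ord_recl big1 ?addr0 ?mul1r // => i _.
by rewrite mul0r.
Qed.

Lemma graded_kercounit Q : normalized Q ->
  graded Q `<=` @kercounit k <-> (1 - 'X) %| Q 0%N.
Proof.
move=> Q0; split=> [sQ|X1Q _ [m [F [-> FQ]]]]; last first.
  rewrite /kercounit /= counit_evalXg; apply/eqP.
  by rewrite -oneBX_dvdp (dvdp_trans X1Q).
have /sQ : graded Q (gpow k (- 0%:Z) * (X ^+ 0 * horner_alg g (Q 0%N))).
  exact/graded_piece.
by rewrite /kercounit /= -evalXg_piece counit_evalXg coef_piece oneBX_dvdp => ->.
Qed.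

Lemma graded_neq0 Q : normalized Q -> graded Q <> [set 0].
Proof.
move=> Q0 eqQ; have : graded Q (gpow k (- 0%:Z) * (X ^+ 0 * horner_alg g (Q 0%N))).
  exact/graded_piece.
rewrite eqQ /= -evalXg_piece oppr0 gpow0 mul1r -evalXg0 => /evalXg_inj.
rewrite mulr1 => /eqP; rewrite polyC_eq0; apply/negP.
exact: horner0_neq0.
Qed.

End CrossedOf.

(** * Codimension in the augmentation ideal *)

Section Codimension.
Context {k : fieldType}.
Local Notation A := (CBplus k).
Local Notation X := (genX k).
Local Notation g := (geng k).
Implicit Types (F G : {poly {poly k}}) (v w : A) (Q : nat -> {poly k}).
Implicit Types (V M : set A) (e : nat -> nat) (I : {fset nat}).

Lemma has_codim_refl V : has_codim V V 0.
Proof.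
exists (fun=> 0); split=> [|v Vv]; first by case.
exists 0; split=> [|c _]; first by rewrite big_ord0 subr0.
by apply/rowP; case.
Qed.

(** Adding w in front of a basis of V / M gives a basis of V / M' when w spans
    M / M'. *)
Lemma has_codimS V M M' r w : is_subspace M -> M `<=` V -> M' `<=` M -> M w ->
    (forall v, M v -> exists! a : k, M' (v - a *: w)) ->
  has_codim V M r -> has_codim V M' r.+1.
Proof.
move=> subM sMV sM'M Mw stepM [e [Ve decV]].
pose e' i := oapp e w (unlift ord0 i).
have sumE (c : 'rV[k]_r.+1) : \sum_i c 0 i *: e' i
    = c 0 ord0 *: w + \sum_i (\row_i c 0 (lift ord0 i)) 0 i *: e i.
  rewrite big_ord_recl /e' unlift_none; congr (_ + _).
  by apply: eq_bigr => i _; rewrite liftK mxE.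
have sumE' v (c : 'rV[k]_r.+1) : v - \sum_i c 0 i *: e' i
    = v - \sum_i (\row_i c 0 (lift ord0 i)) 0 i *: e i - c 0 ord0 *: w.
  by rewrite sumE opprD addrA addrAC.
exists e'; split=> [i|v Vv].
  rewrite /e'; case: unliftP => [j _|_] /=; [exact: Ve | exact: sMV].
have [c [Mc uniq_c]] := decV v Vv; have [a [M'a uniq_a]] := stepM _ Mc.
have rowE (b : 'rV[k]_r.+1) : M (v - \sum_i b 0 i *: e' i) ->
    c = \row_i b 0 (lift ord0 i).
  rewrite sumE' => Mb; apply: uniq_c; rewrite -[X in M X](subrK (b 0 ord0 *: w)).
  by apply: subspaceD => //; apply: subspaceZ.
exists (\row_i oapp (c 0) a (unlift ord0 i)); split=> [|b M'b].
  rewrite sumE' mxE unlift_none /= (_ : \row_i _ = c) //.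
  by apply/rowP => i; rewrite !mxE liftK.
have def_c := rowE b (sM'M _ M'b).
have def_a : a = b 0 ord0 by apply: uniq_a; rewrite def_c -sumE'.
apply/rowP => i; rewrite mxE def_a def_c.
by case: unliftP => [j ->|->] //=; rewrite mxE.
Qed.

(** The sequences with P = 1, with arbitrary exponents: passing from ker epsilon
    to M one dimension at a time may leave the crossed submodules. *)
Definition oneBX_powers e n : {poly k} := (1 - 'X) ^+ e n.

Lemma oneBX_powers_normalized e : normalized (oneBX_powers e).
Proof. by move=> n; rewrite /oneBX_powers horner_exp horner0_oneBX expr1n. Qed.

(** If F_n0 = H Q_n0, subtracting a X^n0 Q_n0(g) changes H to H - a g^m, which
    1 - g divides exactly when a = H(1). *)
Lemma graded_step e n0 (e' := fun n => ((n == n0) + e n)%N) v :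
  graded (oneBX_powers e) v -> exists! a : k,
    graded (oneBX_powers e') (v - a *: (X ^+ n0 * horner_alg g (oneBX_powers e n0))).
Proof.
move=> [m [F [-> FQ]]]; have /dvdpP[H def_H] := FQ n0.
pose G a := F - (('X^m * (a *: oneBX_powers e n0))%:P * 'X^n0).
have GE a : gpow k (- m%:Z) * evalXg F - a *: (X ^+ n0 * horner_alg g (oneBX_powers e n0))
    = gpow k (- m%:Z) * evalXg (G a).
  rewrite /G evalXgB mulrBr; congr (_ - _).
  rewrite polyCM -mulrA evalXgM evalXg_gX mulrA gpowK mul1r evalXg_piece.
  by rewrite -mul_polyC rmorphM /= horner_algC mulr_algl scalerAr.
have powN0 : oneBX_powers e n0 != 0 by rewrite expf_neq0 ?oneBX_neq0.
have GP a : graded (oneBX_powers e') (gpow k (- m%:Z) * evalXg (G a)) <-> H.[1] = a.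
  rewrite gradedP; last exact: oneBX_powers_normalized.
  have G_n0 : (oneBX_powers e' n0 %| (G a)`_n0) = (H.[1] == a).
    rewrite coefB coef_piece eqxx def_H -scalerAr scalerAl -mulrBl.
    rewrite /oneBX_powers /e' eqxx exprD expr1 dvdp_mul2r // oneBX_dvdp.
    by rewrite hornerD hornerN hornerZ hornerXn expr1n mulr1 subr_eq0.
  split=> [/(_ n0)|Ha n]; first by rewrite G_n0 => /eqP.
  have [->|nNn0] := eqVneq n n0; first by rewrite G_n0 Ha.
  rewrite coefB coef_piece (negPf nNn0) subr0 /oneBX_powers /e' (negPf nNn0).
  exact: FQ.
by exists H.[1]; split=> [|a]; rewrite GE GP.
Qed.

(** By induction on the sum: as long as it is positive, some exponent can be
    lowered by 1. *)
Lemma graded_codim e0 e N : (forall n, e0 n <= e n)%N ->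
    (forall n, (N <= n)%N -> e n = e0 n) ->
  has_codim (graded (oneBX_powers e0)) (graded (oneBX_powers e))
    (\sum_(n < N) (e n - e0 n))%N.
Proof.
have [s] := ubnP (\sum_(n < N) (e n - e0 n))%N; elim: s e => // s IHs e.
rewrite ltnS => sum_le le_e eq_e.
have [n0 lt_e|no_lt] := pickP (fun n : 'I_N => e0 n < e n)%N; last first.
  have -> : e = e0.
    apply/funext => n; have [/eq_e //|ltnN] := leqP N n.
    by apply/eqP; rewrite eqn_leq le_e leqNgt (no_lt (Ordinal ltnN)).
  rewrite big1 => [|n _]; first exact: has_codim_refl.
  exact: subnn.
pose e1 n := (e n - (n == n0 :> nat))%N.
have def_e : e = fun n => ((n == n0 :> nat) + e1 n)%N.
  apply/funext => n; rewrite /e1 subnKC //.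
  by case: eqP => // ->; apply: leq_ltn_trans lt_e.
have le_e1 n : (e0 n <= e1 n)%N.
  rewrite /e1; case: eqP => [->|_]; last by rewrite subn0.
  by rewrite subn1 -ltnS prednK // (leq_ltn_trans _ lt_e).
have sumE : (\sum_(n < N) (e n - e0 n) = (\sum_(n < N) (e1 n - e0 n)).+1)%N.
  rewrite (bigD1 n0) //= [in RHS](bigD1 n0) //= -addSn; congr (_ + _)%N.
    have e_gt0 : (0 < e n0)%N by apply: leq_ltn_trans lt_e.
    by rewrite /e1 eqxx subn1 -subSn ?prednK // -ltnS prednK.
  by apply: eq_bigr => n; rewrite /e1 -val_eqE => /negPf/= ->; rewrite subn0.
have nz := oneBX_powers_normalized.
rewrite sumE; apply: (has_codimS _ (graded (oneBX_powers e1)) _ _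
    (X ^+ n0 * horner_alg g (oneBX_powers e1 n0))).
- exact: graded_subspace.
- by apply/(graded_sub _ _ (nz _) (nz _)) => n; apply: dvdp_exp2l.
- by apply/(graded_sub _ _ (nz _) (nz _)) => n; apply: dvdp_exp2l; apply: leq_subr.
- have := (graded_piece _ 0 n0 _ (nz e1)).2 (dvdpp _).
  by rewrite oppr0 gpow0 mul1r.
- by move=> v; rewrite def_e; apply: graded_step.
apply: IHs => // [|n leNn]; first by rewrite -ltnS -sumE.
rewrite /e1 eq_e // (_ : n == n0 :> nat = false) ?subn0 //.
by apply/negbTE; rewrite neq_ltn (leq_trans (ltn_ord n0)) ?orbT.
Qed.

Lemma kercounit_graded :
  @kercounit k = graded (oneBX_powers (fun n => n == 0%N)).
Proof.
apply/seteqP; split=> [v|]; last first.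
  by apply/graded_kercounit; [exact: oneBX_powers_normalized | exact: dvdpp].
have [m [F ->]] := evalXg_onto v; rewrite /kercounit /= counit_evalXg => F1.
exists m, F; split=> // -[|n]; last by rewrite /oneBX_powers /= dvd1p.
by rewrite /oneBX_powers expr1 oneBX_dvdp F1.
Qed.

(** Each i in I is counted once for every n < i. *)
Lemma sum_tail I N : (forall i, i \in I -> (i <= N)%N) ->
  (\sum_(n < N) tail I n = \sum_(i <- I) i)%N.
Proof.
move=> leIN; transitivity (\sum_(n < N) \sum_(i <- I) if (n < i)%N then 1 else 0)%N.
  by apply: eq_bigr => n _; rewrite tailE big_mkcond.
rewrite exchange_big /=; apply: eq_big_seq => i iI.
rewrite -big_mkcond /= -(big_ord_widen N (fun=> 1%N)) ?leIN //.
by rewrite sum1_card card_ord.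
Qed.

Lemma crossed_of_codim I : admissible (1 : {poly k}, I) ->
  has_codim (@kercounit k) (crossed_of (1 : {poly k}, I)) (\sum_(i <- I) i - 1)%N.
Proof.
move=> [_ /= I0 I1]; rewrite crossed_of_graded ?hornerC //.
have {I1} I_neq0 : I != fset0.
  apply/eqP => I_0; case: I1 => // /dvdp_leq.
  by rewrite oner_neq0 size_poly1 -opprB size_polyN size_XsubC => /(_ isT).
have -> : profile (1 : {poly k}, I) = oneBX_powers (tail I).
  by apply/funext => n; rewrite /profile mul1r.
pose N := (\max_(i <- I) i).+1.
have leIN i : i \in I -> (i <= N)%N by move=> iI; apply/leqW/leq_bigmax_seq.
have tail0 := tail_gt0 _ I0 I_neq0.
rewrite kercounit_graded.
have -> : (\sum_(i <- I) i - 1 = \sum_(n < N) (tail I n - (n == 0 :> nat)))%N.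
  rewrite -(sum_tail _ _ leIN) !(big_ord_recl (\max_(i <- I) i)) /= addnBAC //.
  by congr (_ + _ - _)%N; apply: eq_bigr => n _; rewrite subn0.
apply: graded_codim => [[|n]|n leNn] //.
rewrite tail_eq0 => [|i /leIN/leq_trans]; last exact.
by case: n leNn.
Qed.

(** A combination of positive powers of X lying in the subspace has constant
    coefficients divisible by the nonconstant Q n, hence zero; so r + 1 powers
    of X contradict codimension r. *)
Lemma graded_infinite_codim Q : normalized Q -> (forall n, 1 < size (Q n))%N ->
  ~ finite_codim (@kercounit k) (graded Q).
Proof.
move=> Q0 size_Q [r [e [_ decV]]]; have subM := graded_subspace Q.
have /boolp.choice[c Mc] (i : 'I_r.+1) : exists c : 'rV[k]_r,
    graded Q (X ^+ i.+1 - \sum_j c 0 j *: e j).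
  have [|c [Mc _]] := decV (X ^+ i.+1); last by exists c.
  by rewrite /kercounit /= rmorphXn /= counit_X expr0n.
pose C := \matrix_i c i.
(* The r + 1 coordinate vectors in dimension r are dependent. *)
have ker_neq0 : kermx C != 0.
  rewrite -mxrank_eq0 mxrank_ker -lt0n subn_gt0 ltnS.
  exact: rank_leq_col.
have /rowV0Pn[u /sub_kermxP uC uN0] := ker_neq0.
pose G := \sum_(i < r.+1) (u 0 i)%:P%:P * 'X^(i.+1) : {poly {poly k}}.
have MG : graded Q (gpow k (- 0%:Z) * evalXg G).
  rewrite oppr0 gpow0 mul1r.
  have -> : evalXg G = \sum_i u 0 i *: (X ^+ i.+1 - \sum_j c i 0 j *: e j).
    under [RHS]eq_bigr do rewrite scalerBr scaler_sumr.
    rewrite sumrB exchange_big /= [X in _ - X]big1 ?subr0 => [|j _].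
      rewrite [LHS]rmorph_sum; apply: eq_bigr => i _.
      by rewrite [LHS]evalXg_piece horner_algC mulr_algr.
    under eq_bigr do rewrite scalerA.
    rewrite -scaler_suml; have := congr1 (fun w : 'rV_r => w 0 j) uC.
    rewrite !mxE; under eq_bigr do rewrite mxE.
    by move=> ->; rewrite scale0r.
  by apply: subspace_sum => // i _; apply: subspaceZ.
case/eqP: uN0; apply/rowP => i; rewrite mxE.
have := (gradedP Q 0 G Q0).1 MG i.+1.
rewrite coef_sum (bigD1 i) //= big1 ?addr0 => [|j jNi]; last first.
  by rewrite coef_piece eqSS eq_sym (negPf (jNi : val j != i)).
rewrite coef_piece eqxx => Qu; apply/eqP; apply: contraT => ui_neq0.
have := dvdp_leq _ Qu; rewrite polyC_eq0 => /(_ ui_neq0).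
by rewrite size_polyC ui_neq0 leqNgt size_Q.
Qed.

End Codimension.

(** * Maximal crossed submodules *)

Section Maximality.
Context {k : fieldType}.
Local Notation A := (CBplus k).
Implicit Types (r q : {poly k}) (M N : set A) (Q : nat -> {poly k}).
Implicit Types (p : {poly k} * {fset nat}).
Local Notation Xm := (1 - 'X : {poly k}).

Lemma normalized_size_gt1 r : r.[0] = 1 -> r <> 1 -> (1 < size r)%N.
Proof.
move=> r0 rN1; rewrite ltnNge; apply/negP => /size1_polyC def_r.
by move: r0; rewrite {1}def_r hornerC => r_0; apply: rN1; rewrite def_r r_0.
Qed.

(** A normalized nonconstant divisor of least degree is irreducible. *)
Lemma normalized_irreducible_factor q : q.[0] = 1 -> q <> 1 ->
  exists r, [/\ r.[0] = 1, irreducible_poly r & r %| q].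
Proof.
move=> q0 /(normalized_size_gt1 _ q0) q_gt1.
pose P n := `[< exists r, [/\ r.[0] = 1, r %| q, (1 < size r)%N & size r = n] >].
have exP : exists n, P n by exists (size q); apply/asboolP; exists q.
case: (ex_minnP exP) => _ /asboolP[r [r0 rq r_gt1 <-]] min_r.
exists r; split=> //; split=> // s s1 sr; have rN0 := horner0_neq0 _ r0.
have s0 : s.[0] != 0.
  move: r0; have [t ->] := dvdpP _ _ sr; rewrite hornerM.
  by apply: contra_eqN => /eqP->; rewrite mulr0 eq_sym oner_eq0.
have sN0 : s != 0 by apply: contraNneq s0 => ->; rewrite horner0.
rewrite -dvdp_size_eqp // eqn_leq dvdp_leq //=; apply: min_r; apply/asboolP.
exists (s.[0]^-1 *: s); rewrite hornerZ mulVf // dvdpZl ?invr_eq0 //.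
rewrite size_scale ?invr_eq0 //; split=> //; first exact: dvdp_trans rq.
by rewrite ltn_neqAle eq_sym s1 size_poly_gt0.
Qed.

Lemma crossed_of_kercounit p : p.1.[0] = 1 -> 0%N \notin p.2 ->
  crossed_of p `<=` @kercounit k <-> admissible p.
Proof.
move=> p0 pN0; have [Q0 _ _] := profile_staircase _ p0.
rewrite crossed_of_graded // (graded_kercounit _ Q0) /profile.
split=> [dvdX|[_ _ [dvdX|pI]]]; last 2 first.
- exact: dvdp_mulr.
- have {}pI : p.2 != fset0 by apply/eqP.
  by rewrite -(prednK (tail_gt0 _ pN0 pI)) exprS mulrCA dvdp_mulr.
split=> //; have [pI|/eqP] := eqVneq p.2 fset0; last by right.
by left; move: dvdX; rewrite pI tail_eq0 ?mulr1 // => i; rewrite inE.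
Qed.

Lemma crossed_of_admissible p : admissible p ->
  [/\ crossed_submodule (crossed_of p), crossed_of p `<=` @kercounit k
    & crossed_of p <> [set 0]].
Proof.
move=> adm; have [p0 pN0 _] := adm; have stp := profile_staircase _ p0.
split; last 1 first.
- by rewrite crossed_of_graded //; apply: graded_neq0; have [] := stp.
- by rewrite crossed_of_graded //; apply: graded_crossed.
exact/crossed_of_kercounit.
Qed.

Lemma crossed_of_inj p (q : {poly k} * {fset nat}) : admissible p -> admissible q ->
  crossed_of p = crossed_of q -> p = q.
Proof.
move=> [p0 pN0 _] [q0 qN0 _]; rewrite !crossed_of_graded // => eq_pq.
apply: profile_inj => //; apply: graded_inj eq_pq.
  by have [] := profile_staircase _ p0.
by have [] := profile_staircase _ q0.
Qed.

Lemma crossed_of_surj M : [pchar k] =i pred0 -> crossed_submodule M ->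
  M `<=` @kercounit k -> M <> [set 0] -> exists2 p, admissible p & crossed_of p = M.
Proof.
move=> char0 crM kerM MN0; have [Q stQ def_M] := crossed_gradedP M char0 crM MN0.
have [p [p0 pN0 def_Q]] := staircase_profile _ stQ.
have def_Mp : crossed_of p = M by rewrite crossed_of_graded // -def_Q.
by exists p => //; apply/crossed_of_kercounit; rewrite ?def_Mp.
Qed.

Lemma finite_codimP r (I : {fset nat}) : admissible (r, I) ->
  finite_codim (@kercounit k) (crossed_of (r, I)) <-> r = 1.
Proof.
move=> adm; split=> [fin|r1]; last first.
  by rewrite r1 in adm *; eexists; apply: crossed_of_codim.
apply: contrapT => rN1; have [/= r0 _ _] := adm.
have [Q0 _ _] := profile_staircase (r, I) r0.
move: fin; rewrite crossed_of_graded //; apply: graded_infinite_codim => // n.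
apply: leq_trans (normalized_size_gt1 _ r0 rN1) _.
by apply: dvdp_leq; [exact: horner0_neq0 | exact: dvdp_mulr].
Qed.

Lemma kercounit_sub_graded Q : normalized Q ->
  @kercounit k `<=` graded Q <-> Q 0%N %| Xm /\ forall n, Q n.+1 = 1.
Proof.
move=> Q0; rewrite kercounit_graded graded_sub //; last exact: oneBX_powers_normalized.
split=> [dQ|[dQ0 dQ] [|n]].
- split=> [|n]; first exact: (dQ 0%N).
  by apply: normalized_eqp; rewrite ?hornerC // -size_poly_eq1 -dvdp1; apply: (dQ n.+1).
- exact: dQ0.
- by rewrite dQ dvd1p.
Qed.

Lemma crossed_of_proper p : admissible p -> profile p 1 <> 1 ->
  crossed_of p `<` @kercounit k.
Proof.
move=> adm pN1; split; first by have [] := crossed_of_admissible _ adm.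
have [p0 _ _] := adm; have [Q0 _ _] := profile_staircase _ p0.
by rewrite crossed_of_graded // => /(kercounit_sub_graded _ Q0)[_ /(_ 0%N)].
Qed.

Lemma profile1E r n : profile (r, [fset 1%N]%fset) n = r * Xm ^+ (n == 0%N).
Proof. by rewrite /profile tail1; case: n. Qed.

Lemma admissible1 r j : r.[0] = 1 -> (0 < j)%N -> admissible (r, [fset j]%fset).
Proof.
move=> r0 j_gt0; split=> //=; first by rewrite inE eq_sym -lt0n.
by right; move=> /fsetP/(_ j); rewrite !inE eqxx.
Qed.

Lemma irreducible_neq1 r : irreducible_poly r -> r <> 1.
Proof. by move=> [r_gt1 _] r1; rewrite r1 size_poly1 in r_gt1. Qed.

Lemma irreducible_coprime_oneBX r d : r.[0] = 1 -> irreducible_poly r ->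
  r <> Xm -> coprimep r (Xm ^+ d).
Proof.
move=> r0 irr rNX; apply: coprimep_expr; rewrite irreducible_poly_coprime //.
by apply/negP => /(dvdp_oneBX _ r0)[/(irreducible_neq1 _ irr)|].
Qed.

(** A crossed submodule N between (r, {1}) and ker epsilon has all its
    generators in positive degree equal to 1 or r.  These differ only by powers
    of 1 - g, which is prime to r: either all are 1 and N is ker epsilon, or
    all are r and N is (r, {1}), since Q 0 is divisible by r and by 1 - g. *)
Lemma crossed_of_irreducible_maximal r : [pchar k] =i pred0 ->
    r.[0] = 1 -> irreducible_poly r -> r <> Xm ->
  maximal_crossed (crossed_of (r, [fset 1%N]%fset)).
Proof.
move=> char0 r0 irr rNX; have adm := admissible1 _ 1 r0 isT.
have [cr sub nz] := crossed_of_admissible _ adm.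
have [R0 _ _] := profile_staircase (r, [fset 1%N]%fset) r0.
have rN1 := irreducible_neq1 _ irr.
split=> // [|N crN sMN [sNk nkN]].
  by apply: crossed_of_proper => //; rewrite profile1E mulr1.
have NN0 : N <> [set 0].
  move=> N0; apply: nz; apply/seteqP; split; first by rewrite -N0.
  by move=> _ ->; have [[]] := cr.
have [Q stQ def_N] := crossed_gradedP N char0 crN NN0; have [Q0 dQ _] := stQ.
move: sMN sNk nkN; rewrite def_N crossed_of_graded // (graded_sub _ _ R0 Q0).
move=> dR /(graded_kercounit _ Q0) X1Q /(kercounit_sub_graded _ Q0) Qproper.
have Q_1r n : Q n.+1 = 1 \/ Q n.+1 = r.
  have := dR n.+1; rewrite profile1E mulr1 => /(irredp_XsubCP irr)[Q1|Qr].
    by left; apply: normalized_eqp; rewrite ?hornerC.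
  by right; apply: normalized_eqp.
have Q1 : Q 1%N = r.
  case: (Q_1r 0%N) => // Q1; case: Qproper; split=> [|n].
    by have [_ _ /(_ 0%N)] := stQ; rewrite Q1 mulr1.
  apply: normalized_eqp; rewrite ?hornerC // -size_poly_eq1 -dvdp1 -Q1.
  exact: decreasing_dvdp.
have Qr n : Q n.+1 = r.
  case: (Q_1r n) => // Qn1; have := staircase_dvdp _ 1 n stQ.
  rewrite add1n Q1 Qn1 mulr1 => r_dvd.
  have := irreducible_coprime_oneBX _ n r0 irr rNX.
  by rewrite irreducible_poly_coprime // r_dvd.
congr graded; apply/funext => -[|n]; last by rewrite Qr profile1E mulr1.
apply: normalized_dvdp_anti => //; rewrite profile1E Gauss_dvdp.
  by rewrite -{1}Q1 dQ expr1.
exact: irreducible_coprime_oneBX.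
Qed.

(** If M is the submodule of (P, I) and r is an irreducible factor of P other
    than 1 - g, then M lies in (r, {1}) and so equals it.  The factor 1 - g
    cannot occur: M would lie in (1, {2}), which is proper of finite
    codimension. *)
Lemma maximal_infinite_codim M : [pchar k] =i pred0 -> maximal_crossed M ->
    ~ finite_codim (@kercounit k) M ->
  exists r, [/\ r.[0] = 1, irreducible_poly r, r <> Xm
    & crossed_of (r, [fset 1%N]%fset) = M].
Proof.
move=> char0 [crM [sMk nkM] maxM] infM.
have adm2 : admissible (1 : {poly k}, [fset 2%N]%fset).
  by apply: admissible1; rewrite ?hornerC.
have [cr2 _ nz2] := crossed_of_admissible _ adm2.
have X1N1 : Xm <> 1.
  by move=> /(congr1 (horner^~ 1))/eqP; rewrite !hornerE subrr eq_sym oner_eq0.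
have not_below2 : ~ M `<=` crossed_of (1 : {poly k}, [fset 2%N]%fset).
  move=> sM2; apply: infM; rewrite -(maxM _ cr2 sM2).
    exact/finite_codimP.
  by apply: crossed_of_proper => //; rewrite /profile tail1 mul1r expr1.
have MN0 : M <> [set 0].
  by move=> M0; apply: not_below2; rewrite M0 => _ ->; have [[]] := cr2.
have [[P I] adm def_M] := crossed_of_surj M char0 crM sMk MN0.
have [/= P0 I0 _] := adm; have [R0 _ _] := profile_staircase (P, I) P0.
have PN1 : P <> 1 by move=> /(finite_codimP _ _ adm); rewrite def_M.
have [r [r0 irr rP]] := normalized_irreducible_factor _ P0 PN1.
have rQ n : r %| profile (P, I) n by apply: dvdp_mulr.
have rNX : r <> Xm.
  move=> def_r; apply: not_below2; rewrite -def_M !crossed_of_graded ?hornerC //.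
  have [Q0 _ _] := profile_staircase (1 : {poly k}, [fset 2%N]%fset) (hornerC _ _).
  apply/graded_sub => //.
  move=> n; rewrite {1}/profile mul1r tail1 -def_r; case: (n < 2)%N; last exact: dvd1p.
  exact: rQ.
have [cr pr _] := crossed_of_irreducible_maximal _ char0 r0 irr rNX.
exists r; split=> //; apply: maxM => //; rewrite -def_M !crossed_of_graded //.
apply/graded_sub => //; first by have [] := profile_staircase (r, [fset 1%N]%fset) r0.
move=> n; rewrite profile1E Gauss_dvdp; last exact: irreducible_coprime_oneBX.
rewrite rQ; case: n => [|n]; last exact: dvd1p.
by apply/graded_kercounit => //; rewrite -crossed_of_graded // def_M.
Qed.

End Maximality.

Theorem corollary3p2 (k : fieldType) (chark : [pchar k] =i pred0) :
  (* (a) *)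
  (set_bij (@admissible k)
     [set M : set (CBplus k) |
        [/\ crossed_submodule M, M `<=` @kercounit k & M <> [set 0]]]
     (@crossed_of k)
   /\ forall (P : {poly k}) (I : {fset nat}), admissible (P, I) ->
        (finite_codim (@kercounit k) (crossed_of (P, I)) <-> P = 1)
        /\ (P = 1 ->
            has_codim (@kercounit k) (crossed_of (P, I))
              (\sum_(n <- I) n - 1)%N))
  /\
  (* (b) *)
  [set M : set (CBplus k) |
     maximal_crossed M /\ ~ finite_codim (@kercounit k) M]
  = @crossed_of k @` [set p | [/\ admissible p, irreducible_poly p.1,
                                  p.1 <> 1 - 'X & p.2 = [fset 1%N]%fset]].
Proof.
split; [split; [split|]|].
- exact: crossed_of_admissible.
- by move=> p q /[!inE]; apply: crossed_of_inj.
- by move=> M [crM sMk MN0]; have [p] := crossed_of_surj M chark crM sMk MN0; exists p.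
- move=> P I adm; split; first exact: finite_codimP.
  by move=> P1; rewrite P1 in adm *; apply: crossed_of_codim.
apply/seteqP; split=> [M [maxM infM]|_ [[r I] [adm irr rNX /= I1] <-]].
  have [r [r0 irr rNX <-]] := maximal_infinite_codim M chark maxM infM.
  by exists (r, [fset 1%N]%fset) => //; split=> //; apply: admissible1.
have [/= r0 _ _] := adm; split.
  by rewrite I1; apply: crossed_of_irreducible_maximal.
by move=> /(finite_codimP _ _ adm); apply: irreducible_neq1.
Qed.
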